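(* Let $Z=(Z_{\mathbf{x},t})_{(\mathbf{x},t)\in D\times\mathcal{T}}$ be a measurable Gaussian process that is exponentially integrable alongside $\mathcal{T}$ and almost surely continuous in $t$, and let $\Xi=\mathrm{LRPMF}(Z)$. Then, for any $\mathbf{x}\in D$, $\Psi[Z](\mathbf{x},\cdot)$ is almost surely the continuous representer of the Radon-Nikodym derivative $\dfrac{d\Xi_{\mathbf{x}}}{d\lambda}$ (that is, almost surely it is the unique continuous function on $\mathcal{T}$ that is a density of $\Xi_{\mathbf{x}}$ with respect to $\lambda$).
   Context: $(\Omega,\mathcal{F},P)$ is the ambient probability space. $D\subset\mathbb{R}^{d_D}$ ($d_D\ge1$) is compact and convex; $\mathcal{T}\subset\mathbb{R}$ is compact and convex with $\lambda(\mathcal{T})>0$, where $\lambda$ is Lebesgue measure; $\mathcal{B}(\mathcal{T})$ is the Borel $\sigma$-algebra of $\mathcal{T}$. A measurable random field $Z$ on $D\times\mathcal{T}$ is exponentially integrable alongside $\mathcal{T}$ if $\int_{\mathcal{T}}e^{Z_{\mathbf{x},u}(\omega)}\,d\lambda(u)<\infty$ for every $(\mathbf{x},\omega)\in D\times\Omega$. Almost surely continuous in $t$ means that for each $\mathbf{x}\in D$, with probability one, $t\mapsto Z_{\mathbf{x},t}$ is continuous on $\mathcal{T}$. Further, $$\Psi[Z](\mathbf{x},t)=\frac{e^{Z_{\mathbf{x},t}}}{\int_{\mathcal{T}}e^{Z_{\mathbf{x},u}}\,d\lambda(u)},\qquad (\mathbf{x},t)\in D\times\mathcal{T},$$ and $\mathrm{LRPMF}(Z)=(\Xi_{\mathbf{x}})_{\mathbf{x}\in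 D}$ is the random probability measure field defined by $\Xi_{\mathbf{x}}(B)=\int_B\Psi[Z](\mathbf{x},u)\,d\lambda(u)$ for $\mathbf{x}\in D$, $B\in\mathcal{B}(\mathcal{T})$. *)

(* Defs.v *)
From HB Require Import structures.
From mathcomp Require Import all_boot all_order all_algebra.
From mathcomp Require Import all_classical all_reals all_analysis.
From mathcomp Require Import measurable_realfun.
Import Order.TTheory GRing.Theory Num.Theory numFieldNormedType.Exports.

Set Implicit Arguments.
Unset Strict Implicit.
Unset Printing Implicit Defensive.

Local Open Scope classical_set_scope.
Local Open Scope ring_scope.

(* R^n with its Borel sigma-algebra. *)
Notation borel_rV R n := (g_sigma_algebraType (@open 'rV[R]_n)).

(* A random field on D * T is a total function ['rV[R]_n -> R -> Omega -> R];
   its values outside D * T are never constrained nor used. *)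
Section random_fields.
Context d (Omega : measurableType d) (R : realType) (P : probability Omega R).
Context (n : nat) (D : set 'rV[R]_n) (T : set R).
Context (Z : 'rV[R]_n -> R -> Omega -> R).

Definition measurable_field :=
  measurable_fun
    (D `*` T `*` [set: Omega] :
      set (borel_rV R n * measurableTypeR R * Omega))
    (fun q => Z q.1.1 q.1.2 q.2).

(* The normal law with mean m and standard deviation s, where s = 0 gives the
   degenerate law; [normal_prob m 0] is uniform on [0, 1] instead. *)
Definition gaussian_law (m s : R) : set (measurableTypeR R) -> \bar R :=
  if s == 0 then \d_ m else normal_prob m s.

(* The finite-dimensional laws are multivariate normal (possibly degenerate),
   i.e. every linear combination of finitely many values is normal. *)
Definition gaussian_process :=
  forall (k : nat) (a : 'I_k -> R) (x : 'I_k -> 'rV[R]_n) (t : 'I_k -> R),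
    (forall i, D (x i)) -> (forall i, T (t i)) ->
    let X w := \sum_(i < k) a i * Z (x i) (t i) w in
    measurable_fun [set: Omega] X /\
    exists m s : R, forall A : set (measurableTypeR R), measurable A ->
      P (X @^-1` A) = gaussian_law m s A.

Definition exp_integrable := forall x w, D x ->
  (\int[lebesgue_measure]_(u in T) (expR (Z x u w))%:E < +oo)%E.

Definition as_continuous := forall x, D x ->
  {ae P, forall w, {within T, continuous (fun t => Z x t w)}}.

Definition Psi (x : 'rV[R]_n) (t : R) (w : Omega) : R :=
  expR (Z x t w) / \int[lebesgue_measure]_(u in T) expR (Z x u w).

End random_fields.

(* The measure B |-> int_B Psi(x, u) du on T is represented as a measure on the
   whole line carried by T. The proof arguments only make it a probability. *)
Definition LRPMF d (Omega : measurableType d) (R : realType) (n : nat)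
    (D : set 'rV[R]_n) (T : set R) (Z : 'rV[R]_n -> R -> Omega -> R)
    & compact D & compact T & (0 < lebesgue_measure T)%E
    & measurable_field D T Z & exp_integrable D T Z
    := fun (x : 'rV[R]_n) (Dx : D x) (w : Omega) =>
  fun B : set (measurableTypeR R) =>
    (\int[lebesgue_measure]_(u in B `&` T) (Psi T Z x u w)%:E)%E.

Section LRPMF_probability.
Context d (Omega : measurableType d) (R : realType) (n : nat).
Context (D : set 'rV[R]_n) (T : set R) (Z : 'rV[R]_n -> R -> Omega -> R).
Hypotheses (cD : compact D) (cT : compact T).
Hypothesis (T_gt0 : (0 < lebesgue_measure T)%E).
Hypotheses (mZ : measurable_field D T Z) (iZ : exp_integrable D T Z).
Context (x : 'rV[R]_n) (Dx : D x).

Let mu : {sigma_finite_measure set (measurableTypeR R) -> \bar R} := lebesgue_measure.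

Let mT : measurable (T : set (measurableTypeR R)).
Proof. exact: compact_measurable. Qed.

Let mD : measurable (D : set (borel_rV R n)).
Proof.
rewrite -[D]setCK; apply: measurableC; apply: sub_sigma_algebra.
exact/closed_openC/(compact_closed (@norm_hausdorff _ _)).
Qed.

Let measurable_slice :
  measurable_fun (T `*` [set: Omega] : set (measurableTypeR R * Omega))
    (fun q => Z x q.1 q.2).
Proof.
have mDT : measurable
    (D `*` T `*` [set: Omega] :
      set (borel_rV R n * measurableTypeR R * Omega)).
  by apply: measurableX => //; exact: measurableX.
pose g (q : measurableTypeR R * Omega) :=
  (((x : borel_rV R n), q.1), q.2).
rewrite (_ : (fun q => _) =
  (fun q : borel_rV R n * measurableTypeR R * Omega => Z q.1.1 q.1.2 q.2)
    \o g)//.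
apply: (measurable_comp mDT _ mZ).
  by move=> _ [[t w] /= [Tt _]] <-.
apply: measurable_funTS.
apply: measurable_fun_pair => //=; apply: measurable_fun_pair => //=.
Qed.

Let measurable_path w : measurable_fun (T : set (measurableTypeR R))
  (fun u => expR (Z x u w)).
Proof.
apply: measurableT_comp => //.
rewrite (_ : (fun u => _) =
  (fun q : measurableTypeR R * Omega => Z x q.1 q.2)
    \o (fun u : measurableTypeR R => (u, w)))//.
apply: (measurable_comp _ _ measurable_slice).
- exact: measurableX.
- by move=> _ [u Tu] <-.
- exact/measurable_funTS/measurable_fun_pair.
Qed.

Let I w : \bar R := (\int[mu]_(u in T) (expR (Z x u w))%:E)%E.

Let I_gt0 w : (0 < I w)%E.
Proof.
have : (0 <= I w)%E by apply: integral_ge0 => u _; rewrite lee_fin expR_ge0.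
rewrite le_eqVlt => /orP[/eqP I0|//]; exfalso.
have mf : measurable_fun (T : set (measurableTypeR R))
    (fun u => (expR (Z x u w))%:E).
  by apply/measurable_EFinP; exact: measurable_path.
have /(ae_eq_integral_abs mu mT mf)[N [mN N0 TN]] :
    (\int[mu]_(u in T) `|(expR (Z x u w))%:E| = 0)%E.
  by rewrite [RHS]I0; apply: eq_integral => u _; rewrite /= ger0_norm// expR_ge0.
have TsubN : T `<=` N.
  move=> u Tu; apply: TN => /= /(_ Tu) [] /eqP.
  by rewrite gt_eqF ?expR_gt0.
have := T_gt0; rewrite lt_neqAle => /andP[/eqP + _]; apply; apply/esym.
exact: (subset_measure0 (mu := mu) mT mN TsubN N0).
Qed.

Let I_fin w : I w \is a fin_num.
Proof. by rewrite ge0_fin_numE; [exact: iZ|exact: ltW (I_gt0 w)]. Qed.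

Let Psi_ge0 w u : 0 <= Psi T Z x u w.
Proof.
by rewrite /Psi /Rintegral divr_ge0 ?expR_ge0// fine_ge0//; exact: ltW (I_gt0 w).
Qed.

Let measurable_Psi w : measurable_fun (T : set (measurableTypeR R))
  (fun u => (Psi T Z x u w)%:E).
Proof.
by apply/measurable_EFinP/measurable_funM => //; exact: measurable_path.
Qed.

Local Notation Xi := (LRPMF cD cT T_gt0 mZ iZ Dx).

Let LRPMF0 w : Xi w set0 = 0%E.
Proof. by rewrite /LRPMF set0I integral_set0. Qed.

Let LRPMF_ge0 w B : (0 <= Xi w B)%E.
Proof. by apply: integral_ge0 => u _; rewrite lee_fin. Qed.

Let LRPMF_sigma_additive w : semi_sigma_additive (Xi w).
Proof.
move=> F mF tF mUF; rewrite /LRPMF setI_bigcupl ge0_integral_bigcup//=.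
- apply: is_cvg_ereal_nneg_natsum_cond => k _ _.
  by apply: integral_ge0 => u _; rewrite lee_fin.
- by move=> k; exact: measurableI.
- apply: measurable_funS (measurable_Psi w) => //.
  by apply: bigcup_sub => k _; exact: subIsetr.
- by move=> u _; rewrite lee_fin.
- exact: trivIset_setIr.
Qed.

HB.instance Definition _ w := isMeasure.Build _ _ _ (Xi w)
  (LRPMF0 w) (@LRPMF_ge0 w) (@LRPMF_sigma_additive w).

Let LRPMFE w (B : set (measurableTypeR R)) : measurable B ->
  Xi w B = ((fine (I w))^-1%:E *
    \int[mu]_(u in B `&` T) (expR (Z x u w))%:E)%E.
Proof.
move=> mB; rewrite /LRPMF.
under eq_integral do rewrite /Psi mulrC EFinM.
apply: ge0_integralZl.
- exact: measurableI.
- apply: (measurable_funS mT) => //; apply/measurable_EFinP.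
  exact: measurable_path.
- by move=> u _; rewrite lee_fin expR_ge0.
- by rewrite lee_fin invr_ge0 fine_ge0//; exact: ltW (I_gt0 w).
Qed.

Let LRPMF_setT w : Xi w [set: _] = 1%E.
Proof.
rewrite LRPMFE// setTI -/(I w) -[X in (_ * X)%E](fineK (I_fin w)) -EFinM.
by rewrite mulVf// gt_eqF// fine_gt0// I_gt0/= -ge0_fin_numE ?I_fin// ltW ?I_gt0.
Qed.

HB.instance Definition _ w :=
  @Measure_isProbability.Build _ _ R (Xi w) (LRPMF_setT w).

Let measurable_integral (B : set (measurableTypeR R)) : measurable B ->
  measurable_fun [set: Omega]
    (fun w => \int[mu]_(u in B `&` T) (expR (Z x u w))%:E)%E.
Proof.
move=> mB; pose f (q : measurableTypeR R * Omega) := (expR (Z x q.1 q.2))%:E.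
pose BT : set (measurableTypeR R * Omega) := (B `&` T) `*` [set: Omega].
have mBT : measurable BT by apply: measurableX => //; exact: measurableI.
have -> : (fun w => \int[mu]_(u in B `&` T) (expR (Z x u w))%:E)%E =
    fubini_G mu (f \_ BT).
  apply/funext => w; rewrite /fubini_G [LHS]integral_mkcond.
  apply: eq_integral => u _.
  rewrite /patch/= (_ : ((u, w) \in BT) = (u \in B `&` T))//.
  by apply/idP/idP; rewrite !inE; [case|split].
apply: measurable_fun_fubini_tonelli_G.
  apply/(measurable_restrictT _ mBT)/measurable_EFinP/measurableT_comp => //.
  by apply: measurable_funS measurable_slice => //;
    [exact: measurableX|move=> q [[]]].
by move=> q; rewrite /patch; case: ifPn => // _; rewrite lee_fin expR_ge0.
Qed.

Lemma measurable_LRPMF :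
  measurable_fun [set: Omega] (Xi : Omega -> pprobability (measurableTypeR R) R).
Proof.
apply: (measurability
  (@pset _ _ _ : set (set (pprobability (measurableTypeR R) R)))) => //.
move=> _ -[_ [r r01] [B mB <-]] <-.
apply: emeasurable_fun_infty_o => //=.
rewrite [X in measurable_fun _ X](_ : _ = fun w => ((fine (I w))^-1%:E *
    \int[mu]_(u in B `&` T) (expR (Z x u w))%:E)%E); last first.
  by apply/funext => w; exact: LRPMFE.
apply: emeasurable_funM; last exact: measurable_integral.
have := measurable_integral measurableT; rewrite setTI => mI.
apply/measurable_EFinP; apply: (measurable_comp (F := [set r : R | r != 0]) (f := GRing.inv)).
- exact: open_measurable.
- move=> _ [w _ <-] /=.
  by rewrite gt_eqF// fine_gt0// I_gt0/= -ge0_fin_numE ?I_fin// ltW ?I_gt0.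
- apply: open_continuous_measurable_fun => //; apply/in_setP => y /= y0.
  exact: inv_continuous.
- by apply: measurableT_comp.
Qed.

End LRPMF_probability.

Section continuous_versions.
Context (R : realType) (T : set R).

(* h only matters up to Lebesgue-null sets. *)
Definition continuous_representer (h : R -> \bar R) (f : R -> R) :=
  [/\ {within T, continuous f},
      {ae lebesgue_measure, forall t, T t -> (f t)%:E = h t} &
      forall g : R -> R, {within T, continuous g} ->
        {ae lebesgue_measure, forall t, T t -> (g t)%:E = h t} ->
        {in T, g =1 f}].

Definition is_density (nu : set (measurableTypeR R) -> \bar R) (f : R -> R) :=
  measurable_fun (T : set (measurableTypeR R)) f /\
  forall B : set (measurableTypeR R), measurable B -> B `<=` T ->
    nu B = (\int[lebesgue_measure]_(u in B) (f u)%:E)%E.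

Definition unique_continuous_density
    (nu : set (measurableTypeR R) -> \bar R) (f : R -> R) :=
  [/\ {within T, continuous f}, is_density nu f &
      forall g : R -> R, {within T, continuous g} -> is_density nu g ->
        {in T, g =1 f}].

End continuous_versions.

(* Main.v *)
Require Import Defs.
From HB Require Import structures.
From mathcomp Require Import all_boot all_order all_algebra.
From mathcomp Require Import all_classical all_reals all_analysis.
From mathcomp Require Import measurable_realfun ring lra.
Import Order.TTheory GRing.Theory Num.Theory numFieldNormedType.Exports.

Local Open Scope classical_set_scope.
Local Open Scope ring_scope.
Local Open Scope charge_scope.

(* The argument is pathwise.  On the almost sure event where t |-> Z_{x,t} is
   continuous, so is Psi[Z](x, .), and it is a density of Xi_x by construction;
   hence Xi_x is absolutely continuous and Psi[Z](x, .) agrees almost everywhere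
   with its Radon-Nikodym derivative.  Uniqueness holds
   because two functions continuous on a nondegenerate interval that differ at
   one point differ on a subinterval of positive length. *)

Lemma convex_is_interval (R : realType) (T : set R) :
  convex_set (T : set R^o) -> is_interval T.
Proof.
move=> cT x y Tx Ty z /andP[xz zy].
have [yx|xy] := leP y x.
  by rewrite (_ : z = x)//; apply/le_anti; rewrite xz (le_trans zy).
have yx0 : 0 < y - x by rewrite subr_gt0.
(* The number [(y - z) / (y - x)] is the weight of [x] when [z] is written as a convex combination
   of [x] and [y]. *)
have k0 : 0 <= (y - z) / (y - x) by rewrite divr_ge0 ?subr_ge0// ltW.
have k1 : (y - z) / (y - x) <= 1 by rewrite ler_pdivrMr// mul1r lerD2l lerN2.
have -> : z = (y - z) / (y - x) * x + (1 - (y - z) / (y - x)) * y.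
  by field; exact: lt0r_neq0.
by have := cT x y (Itv01 k0 k1); rewrite !inE; exact.
Qed.

Lemma within_continuous_ae_eq (R : realType) (T : set R) (f g : R -> R) :
  is_interval T -> (0 < lebesgue_measure T)%E ->
  {within T, continuous f} -> {within T, continuous g} ->
  {ae lebesgue_measure, forall t, T t -> f t = g t} -> {in T, f =1 g}.
Proof.
move=> iT T0 cf cg [N [mN N0 fgN]] t; rewrite inE => Tt; apply: contrapT => fgt.
(* The difference [f - g] is continuous on [T] and nonzero at [t], so it stays nonzero on a
   neighbourhood of [t] in [T]. *)
have [e e0 fgU] : exists2 e : R, 0 < e &
    forall u, `|t - u| < e -> T u -> f u <> g u.
  have /subspace_continuousP/(_ _ Tt) := within_continuousB cf cg.
  move=> /cvgr_neq0 /(_ _)[].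
    by rewrite subr_eq0; exact/eqP.
  move=> e e0 fg; exists e => // u tu Tu fgu.
  by move/eqP: (fg u tu Tu); apply; rewrite -[LHS]/(f u - g u) fgu subrr.
(* A singleton is Lebesgue-null, so positive measure forces a second point in [T]. *)
have [s Ts st] : exists2 s, T s & s != t.
  apply: contrapT => Tst; move: T0; rewrite lt_neqAle => /andP[/eqP + _]; apply.
  have -> : T = [set t]; last by rewrite lebesgue_measure_set1.
  apply/seteqP; split => [s Ts|_ ->//]; apply: contrapT => /= /eqP st.
  by apply: Tst; exists s.
(* As [t] may be an endpoint of [T], the interval is taken on one side only, towards [s], and cut at
   distance [e] from [t]. *)
have [a [b [ab abT abe]]] : exists a b : R, [/\ a < b, `]a, b[ `<=` T &
    forall u, u \in `]a, b[ -> `|t - u| < e].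
  move: st; rewrite neq_lt => /orP[st|ts].
    exists (Num.max s (t - e)), t; split.
    - by rewrite gt_max st/= ltrBlDr ltrDl.
    - move=> u /=; rewrite in_itv/= gt_max => /andP[/andP[su _] ut].
      by apply: (iT s t) => //; rewrite !ltW.
    - move=> u /=; rewrite in_itv/= gt_max => /andP[/andP[_ tu] ut].
      by rewrite gtr0_norm ?subr_gt0//; lra.
  exists t, (Num.min s (t + e)); split.
  - by rewrite lt_min ts/= ltrDl.
  - move=> u /=; rewrite in_itv/= lt_min => /andP[tu /andP[us _]].
    by apply: (iT t s) => //; rewrite !ltW.
  - move=> u /=; rewrite in_itv/= lt_min => /andP[tu /andP[_ ut]].
    by rewrite ltr0_norm ?subr_lt0//; lra.
have abN : `]a, b[ `<=` N.
  by move=> u uab; apply: fgN => /= /(_ (abT _ uab)); exact: fgU (abe _ uab) (abT _ uab).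
have := subset_measure0 (mu := lebesgue_measure) (measurable_itv _) mN abN N0.
rewrite /= lebesgue_measure_itv/= lte_fin ab -EFinB => -[] /eqP.
by rewrite subr_eq0 gt_eqF.
Qed.

(** Both functions have integral [nu B] over every measurable [B] inside [T]; compactness of [T]
    makes the continuous [f] integrable, so equal integrals give equality almost everywhere. *)
Lemma density_ae_eq (R : realType) (T : set R)
    (nu : set (measurableTypeR R) -> \bar R) (f g : R -> R) :
  compact T -> {within T, continuous f} -> {within T, continuous g} ->
  is_density T nu f -> is_density T nu g ->
  {ae lebesgue_measure, forall t, T t -> f t = g t}.
Proof.
move=> cptT cf cg [_ nuf] [mg nug].
have mT : measurable (T : set (measurableTypeR R)) by exact: compact_measurable.
have : ae_eq lebesgue_measure T (EFin \o f) (EFin \o g).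
  apply: integral_ae_eq => //.
  - exact: continuous_compact_integrable.
  - exact/measurable_EFinP.
  - by move=> E ET mE; rewrite -nuf// nug.
by apply: filterS => t /[apply] -[].
Qed.

Theorem proposition2p4 (d : measure_display) (Omega : measurableType d)
    (R : realType) (P : probability Omega R)
    (dD : nat) (dD_ge1 : (1 <= dD)%N)
    (D : set 'rV[R]_dD) (cptD : compact D) (cvxD : convex_set D)
    (T : set R) (cptT : compact T) (cvxT : convex_set (T : set R^o))
    (T_gt0 : (0 < lebesgue_measure T)%E)
    (Z : 'rV[R]_dD -> R -> Omega -> R)
    (mZ : measurable_field D T Z) (gZ : gaussian_process P D T Z)
    (iZ : exp_integrable D T Z) (cZ : as_continuous P D T Z) :
  let Xi := fun x (Dx : D x) => LRPMF cptD cptT T_gt0 mZ iZ Dx in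
  forall (x : 'rV[R]_dD) (Dx : D x),
    {ae P, forall w,
      continuous_representer T
        ('d (charge_of_finite_measure (Xi x Dx w)) '/d lebesgue_measure)
        (fun t => Psi T Z x t w) /\
      unique_continuous_density T (Xi x Dx w) (fun t => Psi T Z x t w)}.
Proof.
move=> Xi x Dx; apply: filterS (cZ _ Dx) => w cZw.
have iT := convex_is_interval _ _ cvxT.
have mT : measurable (T : set (measurableTypeR R)) by exact: compact_measurable.
have cPsi : {within T, continuous (fun t => Psi T Z x t w)}.
  (* For fixed [w] the denominator does not depend on [t]: [Psi] is the path followed by a
     continuous function of its value. *)
  apply: (@within_continuous_comp _ _ _ T (fun t => Z x t w)
    (fun z => expR z / \int[lebesgue_measure]_(u in T) expR (Z x u w))) => // z _.
  by apply: cvgM; [exact: continuous_expR|exact: cvg_cst].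
have mPsi : measurable_fun (T : set (measurableTypeR R))
    (fun t => Psi T Z x t w).
  exact: subspace_continuous_measurable_fun.
have dPsi : is_density T (Xi x Dx w) (fun t => Psi T Z x t w).
  by split => // B mB BT; rewrite /Xi /LRPMF setIidl.
have XiP : charge_of_finite_measure (Xi x Dx w) `<< lebesgue_measure.
  apply/null_content_dominatesP => B mB B0.
  have mBT : measurable (B `&` T : set (measurableTypeR R)).
    exact: measurableI.
  apply: null_set_integral => //.
    apply/measurable_EFinP; exact: measurable_funS mPsi.
  exact: (subset_measure0 (mu := lebesgue_measure) mBT mB (@subIsetl _ _ _)).
(* By absolute continuity the derivative integrates to the measure of every measurable [B] inside
   [T], as does [Psi]. *)
have PsiRN : {ae lebesgue_measure, forall t, T t -> (Psi T Z x t w)%:E =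
    ('d (charge_of_finite_measure (Xi x Dx w)) '/d lebesgue_measure) t}.
  apply: integral_ae_eq => //.
  - exact: continuous_compact_integrable.
  - have mRN := measurable_int _ (Radon_Nikodym_integrable XiP).
    exact: measurable_funS measurableT _ mRN.
  - by move=> B BT mB; rewrite -Radon_Nikodym_integral// -dPsi.2.
split; split => //.
(* Both [g] and [Psi] agree almost everywhere on [T] with the derivative, hence with each other. *)
- move=> g cg gRN; apply: within_continuous_ae_eq => //.
  have FF : Filter (almost_everywhere (@lebesgue_measure R)).
    exact: ae_filter_ringOfSetsType.
  by apply: filterS2 gRN PsiRN => t gt Pt Tt; apply: EFin_inj; rewrite gt// Pt.
- move=> g cg dg; apply: within_continuous_ae_eq => //.
  exact: (density_ae_eq _ _ _ _ _ cptT cg cPsi dg dPsi).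
Qed.
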